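(* Let $X$ be a Tychonoff space and let $\langle\mu_n\colon n\in\omega\rangle$ be a JN-sequence on $X$. Then there exists a JN-sequence $\langle\nu_n\colon n\in\omega\rangle$ on $X$ such that: (0) $\bigcup_{n\in\omega}\operatorname{supp}(\nu_n)\subseteq\bigcup_{n\in\omega}\operatorname{supp}(\mu_n)$; (1) $\operatorname{supp}(\nu_n)\cap\operatorname{supp}(\nu_k)=\emptyset$ for every $n\neq k\in\omega$; (2) $\bigcup_{n\in\omega}\operatorname{supp}(\nu_n)$ is a discrete subset of $X$ (i.e. discrete in the subspace topology).
   Context: $C(X)$ is the set of all (not necessarily bounded) continuous functions $X\to\mathbb{R}$. A finitely supported (signed Borel) measure on $X$ is a finite linear combination $\mu=\sum_{x\in F}\alpha_x\delta_x$ of one-point (Dirac) measures, with $F\subseteq X$ finite and $\alpha_x\in\mathbb{R}\setminus\{0\}$ for $x\in F$; its support is $\operatorname{supp}(\mu)=F$, its norm is $\|\mu\|=\sum_{x\in F}|\alpha_x|$, and $\mu(f)=\int_X f\,d\mu=\sum_{x\in F}\alpha_xf(x)$. A JN-sequence (finitely supported Josefson--Nissenzweig sequence) on a Tychonoff space $X$ is a sequence $\langle\mu_n\colon n\in\omega\rangle$ of finitely supported signed measures on $X$ such that $\|\mu_n\|=1$ for every $n\in\omega$ and $\lim_{n\to\infty}\mu_n(f)=0$ for every $f\in C(X)$. *)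

(* Defs.v *)
From HB Require Import structures.
From mathcomp Require Export all_boot all_order all_algebra finmap.
From mathcomp Require Export all_classical all_reals all_analysis.

Set Implicit Arguments.
Unset Strict Implicit.
Unset Printing Implicit Defensive.

Import Order.TTheory GRing.Theory Num.Theory.
Import numFieldNormedType.Exports.

Local Open Scope classical_set_scope.
Local Open Scope ring_scope.

Definition tychonoff_space (X : topologicalType) : Prop :=
  hausdorff_space X /\ completely_regular_space X.

(* The library phrases complete regularity through uniformities; this is the
   usual formulation with real-valued functions. *)
Lemma tychonoff_spaceE (R : realType) (X : topologicalType) :
  tychonoff_space X <->
  hausdorff_space X /\
  forall (a : X) (B : set X), closed B -> ~ B a ->
    exists f : X -> R, [/\ continuous f, range f `<=` `[0, 1],
      f a = 0 & forall b, B b -> f b = 1].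
Proof.
split=> -[hX crX]; split=> // a B cB nBa.
  have /(@uniform_separatorP _ R)[f [cf rf fa fB]] := crX a B cB nBa.
  exists f; split => //; first by apply: fa; exists a.
  by move=> b Bb; apply: fB; exists b.
have [f [cf rf fa fB]] := crX a B cB nBa.
apply/(@uniform_separatorP _ R); exists f; split => //.
  by move=> _ [_ -> <-].
by move=> _ [b Bb <-]; exact: fB.
Qed.

(* A finitely supported signed measure \sum_(x in F) alpha_x delta_x with all
   alpha_x nonzero is encoded by its finitely supported weight function
   x |-> alpha_x, so that F = finsupp. *)
Definition fsmeasure (R : realType) (X : topologicalType) : Type :=
  {fsfun X -> R with 0}.

Section Fsmeasure.
Variables (R : realType) (X : topologicalType).
Implicit Types mu : fsmeasure R X.

Definition supp mu : set X := [set` finsupp mu].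

Definition fsnorm mu : R := \sum_(x <- finsupp mu) `|mu x|.

Definition fsint mu (f : X -> R) : R := \sum_(x <- finsupp mu) mu x * f x.

Definition JN_sequence (mu : nat -> fsmeasure R X) : Prop :=
  (forall n, fsnorm (mu n) = 1) /\
  (forall f : X -> R, continuous f -> fsint (mu n) f @[n --> \oo] --> (0 : R)).

End Fsmeasure.

(* subspace A is the library's relative topology on A (in which the points
   outside A are isolated). *)
Definition discrete_subset (X : topologicalType) (A : set X) : Prop :=
  forall B : set X, B `<=` A -> open (B : set (subspace A)).

Lemma discrete_subsetE (X : topologicalType) (A : set X) :
  discrete_subset A <-> isolated A = A.
Proof.
have nbhsA x : A x -> nbhs (x : subspace A) = within A (nbhs x).
  by move=> /nbhs_subspace_in.
split=> [dA|iA B BA].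
  apply/seteqP; split; first exact: isolatedS.
  move=> x Ax; split; first exact: mem_set.
  have xA : [set x] `<=` A by move=> _ ->.
  have : nbhs (x : subspace A) [set x].
    by apply: open_nbhs_nbhs; split=> //; exact: dA.
  rewrite nbhsA// => xn; exists [set y | A y -> y = x]; first exact: xn.
  by apply/seteqP; split=> [y [/[apply]]//|y ->].
rewrite openE => x Bx; have Ax := BA _ Bx.
change (nbhs (x : subspace A) B); rewrite nbhsA//.
have [_ [V xV VA]] : isolated A x by rewrite iA.
apply: filterS xV => y Vy Ay.
by have : (V `&` A) y by []; rewrite VA => ->.
Qed.

(* Main.v *)
Require Import Defs.
From mathcomp Require Import all_boot all_order all_algebra finmap.
From mathcomp Require Import all_classical all_reals all_analysis.
From mathcomp Require Import ring lra.

Set Implicit Arguments.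
Unset Strict Implicit.
Unset Printing Implicit Defensive.

Import Order.TTheory GRing.Theory Num.Theory.
Import numFieldNormedType.Exports.

Local Open Scope classical_set_scope.
Local Open Scope ring_scope.

(* Pairs of the mu_n that are close on a given finite set but at distance at
   least 1/2 exist: along an ultrafilter the weights converge pointwise, while
   a function norming mu_n is almost annihilated by mu_m for m large. Their
   normalized differences form a JN-sequence lam_n tending to 0 at each point.

   Fix an ultrafilter p on nat refining \oo. For each e > 0 there is a finite F
   such that every finite G disjoint from F has a neighbourhood V with
   |lam_n|(V) < e for p-many n. So, for a summable sequence eps_j, one can
   recursively choose indices n_j, finite sets F_j and continuous cutoffs
   1 = h_0 >= h_1 >= ... >= 0, with
     nu_j = lam_(n_j) restricted to the complement of F_j, times h_j,
   such that h_(j+1) vanishes near supp nu_j, which forces disjointness and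
   discreteness, and the step from h_i to h_(i+1) costs each later lam_(n_j) at
   most eps_i of variation. The norms then stay above 1/2. As every continuous
   f is bounded on the union of the supports, nu_j(f) differs from
   lam_(n_j)(h_i f) by O(eps_i) uniformly in j >= i, and h_i f is a fixed
   continuous function, so nu_j(f) tends to 0. *)

(** * Continuous cutoffs on a Tychonoff space *)

Section Bump.
Context {R : realType} {X : topologicalType}.
Hypothesis tychX : tychonoff_space X.

Lemma tychonoff_bump1 (x : X) (V : set X) : open V -> V x ->
  exists g : X -> R, [/\ continuous g, forall y, 0 <= g y <= 1,
    \forall y \near x, g y = 1 & forall y, ~ V y -> g y = 0].
Proof.
move=> oV Vx; have [_ crX] := (tychonoff_spaceE R X).1 tychX.
have [||f [cf f01 fx fV]] := crX x (~` V); first exact: open_closedC.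
  by apply.
have {}f01 y : 0 <= f y <= 1.
  by have /= := f01 (f y); rewrite in_itv; apply; exists y.
(* Truncating at 1 gives the value 1 wherever [f < 1/2], hence on a neighbourhood of [x] and not
   only at [x]. *)
exists (fun y => Num.min 1 (2 * (1 - f y))); split.
- move=> y; apply: (@continuous_min R X (cst 1) (fun y => 2 * (1 - f y))).
    exact: cvg_cst.
  apply: cvgMr; apply: cvgB; [exact: cvg_cst|exact: cf].
- move=> y; have := f01 y; rewrite ge_min lexx/= le_min ler01/=; lra.
- have : \forall y \near x, f y < 1 / 2.
    by apply: (cvgr_lt _ (cf x)); rewrite fx; lra.
  by apply: filterS => y ?; apply/min_idPl; lra.
- move=> y /fV ->; rewrite subrr mulr0; apply/min_idPr; lra.
Qed.

Lemma tychonoff_bump (G : seq X) (V : set X) :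
  open V -> (forall x, x \in G -> V x) ->
  exists g : X -> R, [/\ continuous g, forall y, 0 <= g y <= 1,
    forall x, x \in G -> \forall y \near x, g y = 1 &
    forall y, ~ V y -> g y = 0].
Proof.
move=> oV; elim: G => [|a G IH] GV.
  by exists (cst 0); split=> // [x|y]; [exact: cvg_cst|rewrite /= lexx ler01].
have [|g [cg g01 g1 g0]] := IH.
  by move=> x xG; apply: GV; rewrite inE xG orbT.
have [|h [ch h01 h1 h0]] := @tychonoff_bump1 a V oV.
  by apply: GV; rewrite inE eqxx.
(* A maximum, unlike a sum, keeps the values in [0, 1]. *)
exists (h \max g); split => //=.
- by move=> y; apply: continuous_max; [exact: ch|exact: cg].
- by move=> y; rewrite le_max ge_max; move: (g01 y) (h01 y) => /andP[-> ->] /andP[-> ->].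
- move=> x; rewrite inE => /orP[/eqP->|/g1].
    by apply: filterS h1 => y ->; apply/max_idPl; have /andP[] := g01 y.
  by apply: filterS => y ->; apply/max_idPr; have /andP[] := h01 y.
- by move=> y nVy; rewrite g0// h0// maxxx.
Qed.

Lemma tychonoff_finite_closed (G : seq X) : closed [set` G].
Proof.
have [hX _] := tychX.
by apply: (accessible_finite_set_closed.1 (hausdorff_accessible hX)).
Qed.

Lemma tychonoff_bump_finite (G H : seq X) :
  (forall x, x \in G -> x \notin H) ->
  exists g : X -> R, [/\ continuous g, forall y, 0 <= g y <= 1,
    forall x, x \in G -> g x = 1 & forall x, x \in H -> g x = 0].
Proof.
move=> GH; have [||g [cg g01 g1 g0]] := @tychonoff_bump G (~` [set` H]).
- exact/closed_openC/tychonoff_finite_closed.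
- by move=> x /GH/negP.
exists g; split=> // [x /g1/nbhs_singleton//|x xH].
by apply: g0; apply.
Qed.

Lemma tychonoff_separate_finite (G H : seq X) :
  (forall x, x \in G -> x \notin H) ->
  exists V W : set X, [/\ open V, open W, forall x, x \in G -> V x,
    forall x, x \in H -> W x & forall x, V x -> ~ W x].
Proof.
move=> /tychonoff_bump_finite[g [cg _ g1 g0]].
exists (g @^-1` [set r | 1 / 2 < r]), (g @^-1` [set r | r < 1 / 2]); split => /=.
- by apply: open_comp => [x _|]; [exact: cg|exact: open_gt].
- by apply: open_comp => [x _|]; [exact: cg|exact: open_lt].
- by move=> x /g1 ->; lra.
- by move=> x /g0 ->; lra.
- by move=> x; lra.
Qed.

End Bump.

(** * Measures built from weights, and their variation on sets *)

Section Basics.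
Context {R : realType} {X : topologicalType}.
Implicit Types (mu : fsmeasure R X) (S F : {fset X}) (A B : set X).

Lemma sum_finsupp mu S (G : X -> R) : (finsupp mu `<=` S)%fset ->
  (forall x, mu x = 0 -> G x = 0) ->
  \sum_(x <- finsupp mu) G x = \sum_(x <- S) G x.
Proof.
move=> muS G0; apply: big_fset_incl => // x _ xmu.
by apply: G0; apply: fsfun_dflt.
Qed.

(** [w] may vanish at points of [S], so [S] only bounds the support from above. *)
Definition weighted S (w : X -> R) : fsmeasure R X := [fsfun x in S => w x].

Lemma weightedE S w x : weighted S w x = if x \in S then w x else 0.
Proof. by rewrite fsfunE. Qed.

Lemma finsupp_weighted S w : (finsupp (weighted S w) `<=` S)%fset.
Proof.
apply/fsubsetP => x; rewrite mem_finsupp weightedE.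
by case: ifP => //; rewrite eqxx.
Qed.

Lemma fsnorm_weighted S w : fsnorm (weighted S w) = \sum_(x <- S) `|w x|.
Proof.
rewrite /fsnorm (sum_finsupp (finsupp_weighted S w)) => [|x ->]; last exact: normr0.
by apply: eq_big_seq => x xS; rewrite weightedE xS.
Qed.

Lemma fsint_weighted S w f : fsint (weighted S w) f = \sum_(x <- S) w x * f x.
Proof.
rewrite /fsint (sum_finsupp (finsupp_weighted S w)) => [|x ->]; last exact: mul0r.
by apply: eq_big_seq => x xS; rewrite weightedE xS.
Qed.

(** The total variation [|mu|(A)]; arbitrary [A] are allowed because [mu] is finitely supported. *)
Definition fsvariation mu A : R := \sum_(x <- finsupp mu | x \in A) `|mu x|.

Lemma fsvariation_finset mu F :
  fsvariation mu [set` F] <= \sum_(x <- F) `|mu x|.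
Proof.
rewrite [leRHS](bigID [in finsupp mu])/= -[leLHS]addr0 lerD ?sumr_ge0//.
rewrite /fsvariation -[leLHS]big_filter -[leRHS]big_filter le_eqVlt.
apply/orP; left; apply/eqP; apply: perm_big.
apply: uniq_perm; rewrite ?filter_uniq ?fset_uniq//.
by move=> x; rewrite !mem_filter mem_setE andbC.
Qed.

Lemma fsvariationU mu A B (C : set X) : (forall x, A x -> ~ B x) -> A `|` B `<=` C ->
  fsvariation mu A + fsvariation mu B <= fsvariation mu C.
Proof.
move=> AB ABC; rewrite /fsvariation [leRHS](bigID [in A])/=.
rewrite [leLHS]addrC [leRHS]addrC lerD//.
  rewrite [leRHS](bigID [in B])/=.
  under [X in _ <= X + _]eq_bigl => x.
    rewrite (_ : _ && _ = (x \in B)); last first.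
      apply/idP/idP => [/andP[]//|xB].
      rewrite xB mem_set/= ?andbT; last by apply: ABC; right; exact: set_mem.
      by apply/negP => /set_mem/AB/(_ (set_mem xB)).
    over.
  by rewrite lerDl sumr_ge0.
rewrite le_eqVlt; apply/orP; left; apply/eqP/eq_bigl => x.
apply/idP/idP => [xA|/andP[]//]; rewrite xA andbT.
by apply: mem_set; apply: ABC; left; exact: set_mem.
Qed.

Lemma fsvariation_le_norm mu A : fsvariation mu A <= fsnorm mu.
Proof.
by rewrite /fsnorm [leRHS](bigID [in A])/= lerDl sumr_ge0.
Qed.

End Basics.

(** * Dependent choice with stage-dependent conditions *)

Lemma dependent_choice_nat (S : Type) (P : nat -> S -> Prop)
    (Q : nat -> S -> S -> Prop) (s0 : S) : P 0%N s0 ->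
  (forall j s, P j s -> exists s', P j.+1 s' /\ Q j s s') ->
  exists u : nat -> S, u 0%N = s0 /\
    forall j, P j (u j) /\ Q j (u j) (u j.+1).
Proof.
move=> P0 PQ.
(* Storing the stage number in the state leaves a single fixed relation. *)
have step (t : {js : nat * S | P js.1 js.2}) :
    {t' : {js : nat * S | P js.1 js.2} |
      (sval t').1 = (sval t).1.+1 /\ Q (sval t).1 (sval t).2 (sval t').2}.
  case: t => -[j s] /= Pjs; apply: cid.
  by have [s' [Ps' Qs']] := PQ j s Pjs; exists (exist _ (j.+1, s') Ps').
have [u [u0 uS]] := dependent_choice step (exist _ (0%N, s0) P0).
have uj j : (sval (u j)).1 = j by elim: j => [|j IH]; rewrite ?u0// (uS j).1 IH.
exists (fun j => (sval (u j)).2); split; first by rewrite u0.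
by move=> j; split; [have := svalP (u j)|have := (uS j).2]; rewrite uj.
Qed.

(** * Linearity of the integral *)

Section Linear.
Context {R : realType} {X : topologicalType}.
Implicit Types (mu : fsmeasure R X).

Lemma fsintD mu (f g : X -> R) :
  fsint mu (fun x => f x + g x) = fsint mu f + fsint mu g.
Proof. by rewrite /fsint -big_split/=; apply: eq_bigr => x _; rewrite mulrDr. Qed.

Lemma fsintZ mu c (f : X -> R) : fsint mu (fun x => c * f x) = c * fsint mu f.
Proof. by rewrite /fsint mulr_sumr; apply: eq_bigr => x _; rewrite mulrCA. Qed.

Lemma eq_fsint mu (f g : X -> R) : {in finsupp mu, f =1 g} ->
  fsint mu f = fsint mu g.
Proof. by move=> fg; apply: eq_big_seq => x /fg ->. Qed.

Lemma ler_norm_fset (F : {fset X}) (f : X -> R) x :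
  x \in F -> `|f x| <= \sum_(y <- F) `|f y|.
Proof.
by move=> xF; rewrite (big_fsetD1 x)//= lerDl sumr_ge0.
Qed.

End Linear.

(** * Boundedness of continuous functions on the supports *)

Section Bounded.
Context {R : realType} {X : topologicalType}.
Hypothesis tychX : tychonoff_space X.
Variable mu : nat -> fsmeasure R X.
Hypothesis mu0 : forall f : X -> R, continuous f ->
  fsint (mu n) f @[n --> \oo] --> (0 : R).

Let bounded_initial (f : X -> R) N : exists C, forall n x, (n < N)%N ->
  x \in finsupp (mu n) -> `|f x| <= C.
Proof.
exists (\sum_(n < N) \sum_(y <- finsupp (mu n)) `|f y|) => n x nN xn.
apply: le_trans (ler_norm_fset f xn) _.
by rewrite (bigD1 (Ordinal nN))//= lerDl sumr_ge0// => i _; rewrite sumr_ge0.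
Qed.

Variable f : X -> R.
Hypothesis cf : continuous f.

Let unbounded_tail : ~ (exists C, forall n x, x \in finsupp (mu n) -> `|f x| <= C) ->
  forall N T, exists n x, [/\ (N < n)%N, x \in finsupp (mu n) & T < `|f x|].
Proof.
move=> nb N T; apply: contrapT => H; apply: nb.
have [C HC] := bounded_initial f N.+1; exists (Num.max C T) => n x xn.
have [nN|nN] := ltnP n N.+1; first by rewrite le_max (HC n).
rewrite le_max; apply/orP; right; rewrite leNgt; apply/negP => Tx.
by apply: H; exists n, x.
Qed.

(** A state [(n, T, G)]: an index, a threshold for [|f|] on the support of [mu n], and the function
    built so far. *)
Let state : Type := nat * R * (X -> R).

Let good (s : state) : Prop := [/\ continuous s.2,
  forall x, x \in finsupp (mu s.1.1) -> `|f x| <= s.1.2 &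
  fsint (mu s.1.1) s.2 = 1].

(** Freezing the function where [|f| <= T], with thresholds tending to infinity, makes the stages
    stabilize near each point, so that their limit is continuous. *)
Let next (s s' : state) : Prop := [/\ (s.1.1 < s'.1.1)%N, s.1.2 + 1 <= s'.1.2 &
  forall x, `|f x| <= s.1.2 -> s'.2 x = s.2 x].

(** A bump living where [|f| > T] and meeting the support of [mu n] only at [x0] has nonzero
    integral; adding a multiple of it to [G] brings the integral to 1. *)
Let extend : (forall N T, exists n x,
    [/\ (N < n)%N, x \in finsupp (mu n) & T < `|f x|]) ->
  forall s : state, continuous s.2 -> exists s', good s' /\ next s s'.
Proof.
move=> tail [[N T] G] /= cG; have [n [x0 [Nn x0n Tx]]] := tail N T.
have [|s [cs s01 s1 s0]] := @tychonoff_bump_finite R X tychX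
    [:: x0] [seq x <- finsupp (mu n) | x != x0].
  by move=> x; rewrite inE mem_filter => /eqP->; rewrite eqxx.
pose h x := s x * Num.max 0 (`|f x| - T).
have ch : continuous h.
  move=> x; apply: cvgM; first exact: cs.
  apply: (@continuous_max R X (cst 0) (fun x => `|f x| - T)); first exact: cvg_cst.
  apply: cvgB; last exact: cvg_cst.
  by apply: cvg_norm; exact: cf.
have hx0 : fsint (mu n) h != 0.
  rewrite /fsint (big_fsetD1 x0)//= big_seq big1 ?addr0.
    rewrite /h s1 ?inE// mul1r mulf_neq0//; first by rewrite -mem_finsupp.
    by rewrite lt0r_neq0// lt_max subr_gt0 Tx orbT.
  move=> x; rewrite !inE => /andP[xx0 xn].
  by rewrite /h s0 ?mul0r ?mulr0// mem_filter xx0.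
pose c := (1 - fsint (mu n) G) / fsint (mu n) h.
exists (n, `|T| + 1 + \sum_(x <- finsupp (mu n)) `|f x|, fun x => G x + c * h x).
split; split => //=.
- move=> x; apply: cvgD; first exact: cG.
  by apply: cvgMr; exact: ch.
- move=> x xn; apply: (le_trans (ler_norm_fset f xn)); rewrite lerDr.
  by rewrite addr_ge0.
- by rewrite fsintD fsintZ /c divfK// addrC subrK.
- by rewrite -addrA lerD ?ler_norm ?lerDl ?sumr_ge0.
- move=> x fxT; rewrite /h (_ : Num.max _ _ = 0) ?mulr0 ?addr0//.
  by apply/max_idPl; rewrite subr_le0.
Qed.

(* If f were unbounded, a locally finite sum g of bumps living where |f| is
   large would satisfy mu_(n_k)(g) = 1 along a subsequence. *)
Lemma fsint_cvg0_bounded :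
  exists C, forall n x, x \in finsupp (mu n) -> `|f x| <= C.
Proof.
apply: contrapT => /unbounded_tail/extend ext.
(* The initial triple need not be good: [extend] asks only for continuity. *)
have [|s0 [gs0 _]] := ext (0%N, 0, cst 0); first by move=> x; exact: cvg_cst.
have [|u [_ uP]] := @dependent_choice_nat state (fun=> good) (fun=> next) s0 gs0.
  by move=> j s [cs _ _]; exact: ext.
pose n k := (u k).1.1; pose T k := (u k).1.2; pose G k := (u k).2.
have ncr k : (k <= n k)%N.
  by elim: k => // k IH; have [_ []] := uP k; rewrite -/(n _) => + _ _; exact: leq_ltn_trans.
(* An integral equal to 1 rules out an empty support. *)
have T0 : 0 <= T 0%N.
  have [[_ Tx i1] _] := uP 0%N; rewrite leNgt; apply/negP => T0.
  move/eqP: i1; rewrite /fsint big_seq big1 ?(eq_sym 0) ?oner_eq0// => x xn.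
  by have := Tx _ xn; have := normr_ge0 (f x); move: T0; rewrite /T; lra.
have Tge k : k%:R <= T k.
  elim: k => // k IH; have [_ [_ + _]] := uP k; rewrite -!/(T _) -natr1.
  by apply: le_trans; rewrite lerD2r.
have TS k : T k <= T k.+1.
  by have [_ [_ + _]] := uP k; rewrite -!/(T _); lra.
have Gst k m x : `|f x| <= T k -> (k <= m)%N -> G m x = G k x.
  move=> fT; elim: m => [|m IH]; first by rewrite leqn0 => /eqP->.
  rewrite leq_eqVlt => /orP[/eqP<-//|]; rewrite ltnS => km.
  rewrite -IH//; have [_ [_ _ ]] := uP m; apply; rewrite -/(T _).
  apply: (le_trans fT); elim: m km {IH} => [|m IH]; first by rewrite leqn0 => /eqP->.
  by rewrite leq_eqVlt => /orP[/eqP->//|/IH/le_trans]; apply.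
pose K x := (Num.trunc `|f x|).+1.
have KT x : `|f x| <= T (K x).
  by apply: le_trans (Tge _); exact/ltW/truncnS_gt.
pose g x := G (K x) x.
have gE k x : `|f x| <= T k -> g x = G k x.
  move=> fT; rewrite /g; have [kK|/ltnW Kk] := leqP k (K x); first exact: Gst.
  by rewrite (Gst _ _ _ (KT x) Kk).
(* A strict bound [|f x| < T k] persists near [x], where [g] then agrees with [G k]. *)
have cg : continuous g.
  move=> x; have [k xk] : exists k, `|f x| < T k.
    exists (K x).+1; have [_ [_ + _]] := uP (K x); rewrite -!/(T _).
    by have := KT x; lra.
  have gG : \forall y \near x, G k y = g y.
    have : \forall y \near x, `|f y| < T k.
      by apply: (cvgr_lt `|f x|) => //; apply: cvg_norm; exact: cf.
    by apply: filterS => y /ltW /gE ->.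
  apply: (cvg_trans (near_eq_cvg gG)); rewrite (gE k) ?ltW//.
  by have [[cG _ _] _] := uP k; exact: cG.
have /cvgr0_norm_lt/(_ 1 ltr01)[N _ /(_ (n N) (ncr N))/=] := mu0 cg.
have [[_ Tx i1] _] := uP N.
by rewrite (eq_fsint (g := G N)) ?i1 ?normr1 ?ltxx// => x xn; apply/gE/Tx.
Qed.

End Bounded.

(** * Reduction to weights tending to zero at each point *)

(** The image ultrafilter contains the compact interval [-1, 1], so it clusters at some [z]; being
    an ultrafilter, [p] then contains the set of [n] with [u n] within [d / 2] of [z]. *)
Lemma ultra_cauchy {R : realType} {T : Type} (p : set_system T)
    (u : T -> R) (d : R) : UltraFilter p ->
  (forall n, `|u n| <= 1) -> 0 < d ->
  exists2 A, p A & forall n m, A n -> A m -> `|u n - u m| < d.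
Proof.
move=> pU u1 d0; pose l := u @ p.
have l1 : l `[-1, 1]%classic.
  by apply: (@filterE _ p) => n /=; rewrite in_itv/= -ler_norml; exact: u1.
have [z [_ clz]] := @segment_compact R (-1) 1 l _ l1.
exists [set n | `|z - u n| < d / 2].
  have [//|pC] := in_ultra_setVsetC [set n | `|z - u n| < d / 2] pU.
  have [] := clz [set r | ~ `|z - r| < d / 2] (ball z (d / 2)) pC _.
    by apply: nbhsx_ballx; rewrite divr_gt0.
  by move=> r [/=].
move=> n m /= un um; have := ler_distD z (u n) (u m); rewrite (distrC (u n) z); lra.
Qed.

Section Difference.
Context {R : realType} {X : topologicalType}.

Lemma ler_fsnorm (mu : fsmeasure R X) x : `|mu x| <= fsnorm mu.
Proof.
have [xn|/fsfun_dflt->] := boolP (x \in finsupp mu); first exact: ler_norm_fset.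
by rewrite normr0 sumr_ge0.
Qed.

Lemma ultra_cauchy_fin (p : set_system nat) (mu : nat -> fsmeasure R X)
    (s : seq X) (d : R) : UltraFilter p ->
  (forall n, fsnorm (mu n) = 1) -> 0 < d ->
  exists2 A, p A &
    forall n m x, A n -> A m -> x \in s -> `|mu n x - mu m x| < d.
Proof.
move=> pU mu1 d0; elim: s => [|x s [A pA HA]].
  by exists setT => //; exact: filterT.
have [|B pB HB] := @ultra_cauchy R nat p (fun n => mu n x) d pU _ d0.
  by move=> n; rewrite -(mu1 n) ler_fsnorm.
exists (A `&` B); first exact: filterI.
move=> n m y [An Bn] [Am Bm]; rewrite inE => /orP[/eqP->|ys]; first exact: HB.
exact: HA.
Qed.

Hypothesis tychX : tychonoff_space X.
Variable mu : nat -> fsmeasure R X.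
Hypothesis JNmu : JN_sequence mu.

(** A bump separating positive from negative weights, rescaled to [-1, 1], is the sign of the weight
    on the support. *)
Lemma fsmeasure_sign_function (nu : fsmeasure R X) :
  exists f : X -> R, [/\ continuous f, forall x, `|f x| <= 1 &
    fsint nu f = fsnorm nu].
Proof.
have [|g [cg g01 g1 g0]] := @tychonoff_bump_finite R X tychX
    [seq x <- finsupp nu | 0 < nu x] [seq x <- finsupp nu | nu x < 0].
  by move=> x; rewrite !mem_filter => /andP[/ltW x0 ->]; rewrite ltNge x0.
exists (fun x => 2 * g x - 1); split.
- by move=> x; apply: cvgB; [apply: cvgMr; exact: cg|exact: cvg_cst].
- by move=> x; rewrite ler_norml; have := g01 x; lra.
- apply: eq_big_seq => x xn; have [x0|x0|x0] := ltgtP (nu x) 0.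
  + by rewrite g0 ?mem_filter ?x0// ltr0_norm//; lra.
  + by rewrite g1 ?mem_filter ?x0// gtr0_norm//; lra.
  + by rewrite x0 mul0r normr0.
Qed.

Lemma fsint_widen (nu : fsmeasure R X) (S : {fset X}) (f : X -> R) :
  (finsupp nu `<=` S)%fset -> fsint nu f = \sum_(x <- S) nu x * f x.
Proof. by move=> nuS; apply: sum_finsupp => // x ->; rewrite mul0r. Qed.

(* Along an ultrafilter the weights on a finite set are Cauchy, while a
   function norming mu n almost annihilates mu m for m large. *)
Lemma separated_pair (N : nat) (F : {fset X}) (d : R) : 0 < d ->
  exists n m, [/\ (N <= n)%N, (N <= m)%N,
    forall x, x \in F -> `|mu n x - mu m x| < d &
    1 / 2 <= \sum_(x <- (finsupp (mu n) `|` finsupp (mu m))%fset)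
                 `|mu n x - mu m x|].
Proof.
move=> d0; have [mu1 mu0] := JNmu.
have [p [pU poo]] := @ultraFilterLemma nat \oo _.
have pge k : p [set n | (k <= n)%N] by apply: poo; exists k.
have [A pA HA] := @ultra_cauchy_fin p mu F d pU mu1 d0.
have /filter_ex[n [An Nn]] : p (A `&` [set n | (N <= n)%N]) by exact: filterI.
have [f [cf f1 fn]] := fsmeasure_sign_function (mu n).
have half : (0 : R) < 1 / 2 by lra.
have pf : p [set m | `|fsint (mu m) f| < 1 / 2].
  by apply: poo; have /cvgr0_norm_lt/(_ _ half) := mu0 f cf.
have /filter_ex[m [[Am Nm] /= fm]] :
  p (A `&` [set m | (N <= m)%N] `&` [set m | `|fsint (mu m) f| < 1 / 2]).
  by apply: filterI => //; exact: filterI.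
exists n, m; split => // [x xF|]; first exact: HA.
set S := (_ `|` _)%fset.
(* [f] integrates to 1 against [mu n] and to less than 1/2 against [mu m]; as [|f| <= 1], the gap
   bounds the norm of the difference from below. *)
apply: (@le_trans _ _ (fsint (mu n) f - fsint (mu m) f)).
  by rewrite fn mu1; move: fm; rewrite ltr_norml; lra.
rewrite (@fsint_widen _ S) ?fsubsetUl// (@fsint_widen _ S) ?fsubsetUr//.
rewrite -sumrB ler_sum// => x _; rewrite -mulrBl (le_trans (ler_norm _))//.
by rewrite normrM ler_piMr.
Qed.

Lemma finsupp_initial N :
  exists S : {fset X}, forall k, (k < N)%N -> (finsupp (mu k) `<=` S)%fset.
Proof.
elim: N => [|N [S HS]]; first by exists fset0.
exists (S `|` finsupp (mu N))%fset => k; rewrite ltnS leq_eqVlt.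
move=> /orP[/eqP->|/HS kS]; first exact: fsubsetUr.
exact: fsubset_trans (fsubsetUl _ _).
Qed.

(** The [N]-th pair has indices at least [N] and is close up to [1/(N+1)] on a finite set containing
    the supports of all earlier [mu k], which eventually captures each point of any support.
    Normalizing costs at most a factor 2. *)
Lemma JN_pointwise_null : exists lam : nat -> fsmeasure R X,
  [/\ JN_sequence lam, \bigcup_n supp (lam n) `<=` \bigcup_n supp (mu n) &
      forall x, lam n x @[n --> \oo] --> (0 : R)].
Proof.
have [mu1 mu0] := JNmu.
have [D HD] := choice finsupp_initial.
have d0 N : (0 : R) < N.+1%:R^-1 by rewrite invr_gt0.
have [n /choice[m nm]] := choice (fun N => separated_pair N (D N) (d0 N)).
pose S N := (finsupp (mu (n N)) `|` finsupp (mu (m N)))%fset.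
pose c N := \sum_(x <- S N) `|mu (n N) x - mu (m N) x|.
have c2 N : 1 / 2 <= c N by have [] := nm N.
have c0 N : 0 < c N by have := c2 N; lra.
have ci N : (c N)^-1 <= 2.
  by rewrite invf_ple ?posrE//; have := c2 N; lra.
pose lam N := weighted (S N) (fun x => (c N)^-1 * (mu (n N) x - mu (m N) x)).
have lamE N x : lam N x = (c N)^-1 * (mu (n N) x - mu (m N) x).
  rewrite weightedE; case: ifPn => //.
  rewrite inE negb_or => /andP[/fsfun_dflt-> /fsfun_dflt->].
  by rewrite subrr mulr0.
have ncr : n N @[N --> \oo] --> \oo.
  by apply/cvgnyPge => A; exists A => // k /= Ak; have [kn _ _ _] := nm k; exact: leq_trans kn.
have mcr : m N @[N --> \oo] --> \oo.
  by apply/cvgnyPge => A; exists A => // k /= Ak; have [_ kn _ _] := nm k; exact: leq_trans kn.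
exists lam; split.
- split=> [N|f cf].
    rewrite fsnorm_weighted.
    under eq_bigr do rewrite normrM (ger0_norm (ltW _)) ?invr_gt0//.
    by rewrite -mulr_sumr mulVf// gt_eqF.
  have lamf N : fsint (lam N) f = (c N)^-1 * (fsint (mu (n N)) f - fsint (mu (m N)) f).
    rewrite fsint_weighted (@fsint_widen (mu (n N)) (S N)) ?fsubsetUl//.
    rewrite (@fsint_widen (mu (m N)) (S N)) ?fsubsetUr//.
    rewrite -sumrB mulr_sumr; apply: eq_bigr => x _; ring.
  have diff0 : 2 * `|fsint (mu (n N)) f - fsint (mu (m N)) f| @[N --> \oo] --> (0 : R).
    rewrite -[X in _ --> X](mulr0 2); apply: cvgMr.
    have := cvg_norm (cvgB (cvg_comp _ _ ncr (mu0 f cf)) (cvg_comp _ _ mcr (mu0 f cf))).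
    by rewrite subr0 normr0; exact.
  apply/norm_cvg0P; apply: (squeeze_cvgr _ _ diff0); last exact: cvg_cst.
  apply: nearW => N; rewrite normr_ge0/= lamf normrM ler_wpM2r//.
  by rewrite ger0_norm// invr_ge0 ltW.
- move=> x [N _ xN]; have /fsubsetP/(_ x xN) : (finsupp (lam N) `<=` S N)%fset.
    exact: finsupp_weighted.
  by rewrite inE => /orP[]; [exists (n N)|exists (m N)].
- move=> x; have [[k xk]|nx] := pselect (exists k, x \in finsupp (mu k)); last first.
    have lam0 N : lam N x = 0.
      have mux k : mu k x = 0.
        by apply: fsfun_dflt; apply/negP => xk; apply: nx; exists k.
      by rewrite lamE !mux subrr mulr0.
    rewrite (_ : (fun N => lam N x) = cst 0); first exact: cvg_cst.
    exact/funext.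
  have h0 : 2 * N.+1%:R^-1 @[N --> \oo] --> (0 : R).
    by rewrite -[X in _ --> X](mulr0 2); apply: cvgMr; exact: cvg_harmonic.
  apply/norm_cvg0P; apply: (squeeze_cvgr _ _ h0); last exact: cvg_cst.
  near=> N; rewrite normr_ge0/= lamE normrM ler_pM//.
    by rewrite ger0_norm// invr_ge0 ltW.
  have [_ _ + _] := nm N; move/(_ x) => H; apply/ltW/H.
  apply: (fsubsetP (HD N k _)) => //.
  by near: N; exists k.+1.
Unshelve. all: by end_near. Qed.

End Difference.

(** * Disjoint and discrete supports by successive cutoffs *)

Section DisjointDiscrete.
Context {R : realType} {X : topologicalType}.
Hypothesis tychX : tychonoff_space X.
Variable lam : nat -> fsmeasure R X.
Hypothesis JNlam : JN_sequence lam.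
Hypothesis lam_null : forall x, lam n x @[n --> \oo] --> (0 : R).

Let lam1 n : fsnorm (lam n) = 1. Proof. exact: JNlam.1. Qed.

Lemma sum_null (s : seq X) : \sum_(x <- s) `|lam n x| @[n --> \oo] --> (0 : R).
Proof.
elim: s => [|x s IH].
  by under eq_fun do rewrite big_nil; exact: cvg_cst.
under eq_fun do rewrite big_cons.
by have := cvgD (cvg_norm (lam_null x)) IH; rewrite normr0 addr0; exact.
Qed.

(* Otherwise there would be arbitrarily many pairwise disjoint finite sets, all
   of whose neighbourhoods carry at least e of the variation along p; separating
   them would push the norm beyond 1. *)
Lemma small_neighbourhoods (p : set_system nat) (e : R) :
  UltraFilter p -> 0 < e ->
  exists F : {fset X}, forall G : {fset X}, (forall x, x \in G -> x \notin F) ->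
    exists V, [/\ open V, forall x, x \in G -> V x &
      p [set n | fsvariation (lam n) V < e]].
Proof.
move=> pU e0; apply: contrapT => H.
have bad (F : {fset X}) : exists G : {fset X}, (forall x, x \in G -> x \notin F) /\
    forall V, open V -> (forall x, x \in G -> V x) ->
    p [set n | e <= fsvariation (lam n) V].
  apply: contrapT => HF; apply: H; exists F => G GF.
  apply: contrapT => HG; apply: HF; exists G; split => // V oV GV.
  have [pV|] := in_ultra_setVsetC [set n | fsvariation (lam n) V < e] pU.
    by exfalso; apply: HG; exists V.
  by apply: filterS => n /= /negP; rewrite -leNgt.
have [N HN] : exists N : nat, 1 < e * N%:R.
  exists (Num.trunc e^-1).+1; rewrite -ltr_pdivrMl// mulr1.
  exact: truncnS_gt.
have [G HG] : exists G : {fset X}, forall V, open V ->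
    (forall x, x \in G -> V x) -> p [set n | e * N%:R <= fsvariation (lam n) V].
  elim: N {HN} => [|N [G IH]].
    exists fset0 => V _ _; apply: filterE => n /=.
    by rewrite mulr0 sumr_ge0.
  (* Avoiding the set accumulated so far makes the new set disjoint from it. *)
  have [G' [GG' HG']] := bad G.
  exists (G `|` G')%fset => V oV GV.
  have [|W [W' [oW oW' GW GW' WW']]] := @tychonoff_separate_finite R X tychX G G'.
    by move=> x xG; apply/negP => /GG'; rewrite xG.
  have pW : p [set n | e * N%:R <= fsvariation (lam n) (V `&` W)].
    apply: IH => [|x xG]; first exact: openI.
    by split; [apply: GV; rewrite inE xG|exact: GW].
  have pW' : p [set n | e <= fsvariation (lam n) (V `&` W')].
    apply: HG' => [|x xG']; first exact: openI.
    by split; [apply: GV; rewrite inE xG' orbT|exact: GW'].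
  apply: filterS (filterI pW pW') => n /= [v1 v2].
  rewrite -natr1 mulrDr mulr1; apply: (le_trans (lerD v1 v2)).
  apply: fsvariationU => [x [_ Wx] [_ /(WW' _ Wx)//]|].
  by move=> x [[]|[]].
have /filter_ex[n /= Hn] := HG setT openT (fun _ _ => I).
by have := le_trans Hn (fsvariation_le_norm (lam n) setT); rewrite lam1; lra.
Qed.

(** The tail from [i] on sums to [2 * eps i]; in particular the total loss is at most 1/2. *)
Let eps (j : nat) : R := (1 / 2) ^+ j.+2.

Let eps_gt0 j : 0 < eps j.
Proof. by rewrite exprn_gt0//; lra. Qed.

Let epsS j : eps j = eps j.+1 *+ 2.
Proof. by rewrite /eps (exprS _ j.+2) -mulr_natr; lra. Qed.

Let eps_cvg0 : eps j @[j --> \oo] --> (0 : R).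
Proof.
have h : `|1 / 2 : R| < 1 by rewrite ger0_norm; lra.
by have := cvg_expr h; rewrite -(cvg_shiftn 2); under eq_fun do rewrite addn2.
Qed.

(** A state is the set of indices still admissible with the current cutoff; [kF] is the chosen index
    with the finite set removed from its support. *)
Definition cutoff_step (j : nat) (s s' : set nat * (X -> R))
    (kF : nat * {fset X}) : Prop :=
  [/\ s.1 kF.1, (j <= kF.1)%N, \sum_(x <- kF.2) `|lam kF.1 x| < eps j,
    forall x, x \in finsupp (lam kF.1) -> x \notin kF.2 ->
      \forall y \near x, s'.2 y = 0 &
    [/\ s'.1 `<=` s.1, forall x, s'.2 x <= s.2 x &
    forall n, s'.1 n -> \sum_(x <- finsupp (lam n)) `|lam n x| * (s.2 x - s'.2 x)
      <= eps j]].

(** Off the exceptional set [F], the support of the chosen [lam k] has a neighbourhood [V] of small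
    variation for [p]-many [n]. Only these [n] stay admissible, and [h] is multiplied by [1 - g] for
    a bump [g] inside [V]. *)
Lemma cutoff_extend (p : set_system nat) (j : nat) (s : set nat * (X -> R)) :
  UltraFilter p -> \oo `<=` p ->
  p s.1 -> continuous s.2 -> (forall x, 0 <= s.2 x <= 1) ->
  exists s' : set nat * (X -> R), [/\ p s'.1, continuous s'.2, forall x, 0 <= s'.2 x <= 1 &
    exists kF, cutoff_step j s s' kF].
Proof.
case: s => B h /= pU poo pB ch h01.
have [F HF] := @small_neighbourhoods p (eps j) pU (eps_gt0 j).
have pF : p [set n | \sum_(x <- F) `|lam n x| < eps j].
  by apply: poo; apply: (cvgr_lt _ (sum_null F)).
have pj : p [set n | (j <= n)%N] by apply: poo; exists j.
have /filter_ex[k [[Bk jk] /= Fk]] : p (B `&` [set n | (j <= n)%N]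
    `&` [set n | \sum_(x <- F) `|lam n x| < eps j]).
  by apply: filterI => //; exact: filterI.
have [|V [oV GV pV]] := HF (finsupp (lam k) `\` F)%fset.
  by move=> x; rewrite inE => /andP[].
have [g [cg g01 g1 g0]] := @tychonoff_bump R X tychX _ _ oV GV.
exists (B `&` [set n | fsvariation (lam n) V < eps j], fun x => h x * (1 - g x)).
split => /=.
- exact: filterI.
- move=> x; apply: cvgM; first exact: ch.
  by apply: cvgB; [exact: cvg_cst|exact: cg].
- move=> x; have := h01 x; have := g01 x => /andP[? ?] /andP[? ?].
  by rewrite mulr_ge0 ?mulr_ile1//; lra.
- exists (k, F); split => //=.
    move=> x xk xF; have := g1 x; rewrite inE xF xk => /(_ isT).
    by apply: filterS => y ->; rewrite subrr mulr0.
  split.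
  + by move=> n [].
  + move=> x; have := h01 x; have := g01 x => /andP[? ?] /andP[? ?].
    by rewrite ler_piMr//; lra.
  (* The loss [h * g] is at most 1 on [V] and vanishes off [V]. *)
  + move=> n [_ /= /ltW]; apply: le_trans.
    rewrite /fsvariation [leRHS]big_mkcond/= ler_sum// => x _.
    have := h01 x; have := g01 x => /andP[? ?] /andP[? ?].
    have [xV|/negP xV] := boolP (x \in V).
      by rewrite ler_piMr//; nra.
    by rewrite g0 ?subr0 ?mulr1 ?subrr ?mulr0// => /mem_set.
Qed.

Lemma cutoff_sequence : exists (n : nat -> nat) (F : nat -> {fset X})
    (h : nat -> X -> R),
  [/\ forall j, continuous (h j),
      forall x, h 0%N x = 1,
      forall j x, 0 <= h j.+1 x <= h j x,
      forall j, (j <= n j)%N /\ \sum_(x <- F j) `|lam (n j) x| < eps j &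
      (forall j x, x \in finsupp (lam (n j)) -> x \notin F j ->
        \forall y \near x, h j.+1 y = 0) /\
      (forall i j, (i < j)%N -> \sum_(x <- finsupp (lam (n j)))
        `|lam (n j) x| * (h i x - h i.+1 x) <= eps i)].
Proof.
have [p [pU poo]] := @ultraFilterLemma nat \oo _.
pose P (s : set nat * (X -> R)) :=
  [/\ p s.1, continuous s.2 & forall x, 0 <= s.2 x <= 1].
pose Q j s s' := exists kF, cutoff_step j s s' kF.
have P0 : P (setT, cst 1).
  by split=> /= [|x|x]; [exact: filterT|exact: cvg_cst|rewrite ler01 lexx].
have PQ j s : P s -> exists s', P s' /\ Q j s s'.
  move=> [ps cs s01]; have [s' [ps' cs' s01' Qs']] := cutoff_extend j pU poo ps cs s01.
  by exists s'; split.
have [u [u0 uP]] := @dependent_choice_nat _ (fun=> P) Q _ P0 PQ.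
have /choice[kF kFP] : forall j, exists kF, cutoff_step j (u j) (u j.+1) kF.
  by move=> j; exact: (uP j).2.
exists (fun j => (kF j).1), (fun j => (kF j).2), (fun j => (u j).2).
(* Admissible sets decrease, so every later index obeys the bound fixed at stage [i]. *)
have usub i j : (i <= j)%N -> (u j).1 `<=` (u i).1.
  elim: j => [|j IH]; first by rewrite leqn0 => /eqP->.
  rewrite leq_eqVlt => /orP[/eqP<-//|/IH]; apply: subset_trans.
  by have [_ _ _ _ []] := kFP j.
split.
- by move=> j; have [[]] := uP j.
- by move=> x; rewrite u0.
- move=> j x; have [_ _ _ _ [_ -> _]] := kFP j; rewrite andbT.
  by have [[_ _ /(_ x)/andP[]]] := uP j.+1.
- by move=> j; have [_ ? ? _ _] := kFP j.
- split=> [j x|i j ij]; first by have [_ _ _ + _] := kFP j; exact.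
  have [_ _ _ _ [_ _]] := kFP i; apply; apply: (usub _ _ ij).
  by have [] := kFP j.
Qed.

Lemma disjoint_discrete_JN : exists nu : nat -> fsmeasure R X,
  [/\ JN_sequence nu,
      \bigcup_n supp (nu n) `<=` \bigcup_n supp (lam n),
      forall n k : nat, n <> k -> supp (nu n) `&` supp (nu k) = set0 &
      discrete_subset (\bigcup_n supp (nu n))].
Proof.
have [n [F [h [ch h0 hS nF [hvan hsmall]]]]] := cutoff_sequence.
have hge0 j x : 0 <= h j x.
  by case: j => [|j]; [rewrite h0|have /andP[] := hS j x].
have hle i j x : (i <= j)%N -> h j x <= h i x.
  elim: j => [|j IH]; first by rewrite leqn0 => /eqP->.
  rewrite leq_eqVlt => /orP[/eqP<-//|/IH]; apply: le_trans.
  by have /andP[] := hS j x.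
pose S j := finsupp (lam (n j)).
pose w j x := if x \in F j then 0 else lam (n j) x * h j x.

have tele i j l : (i <= l <= j)%N ->
    \sum_(x <- S j) `|lam (n j) x| * (h i x - h l x) <= 2 * eps i - 2 * eps l.
  move=> /andP[]; elim: l => [|l IH].
    rewrite leqn0 => /eqP-> _; rewrite big1 ?subrr// => x _.
    by rewrite subrr mulr0.
  rewrite leq_eqVlt => /orP[/eqP->|] lj.
    by rewrite big1 ?subrr// => x _; rewrite subrr mulr0.
  move=> lj'; have IHl := IH lj (ltnW lj'); have sm := hsmall l j lj'.
  have -> : \sum_(x <- S j) `|lam (n j) x| * (h i x - h l.+1 x) =
    \sum_(x <- S j) `|lam (n j) x| * (h i x - h l x) +
    \sum_(x <- S j) `|lam (n j) x| * (h l x - h l.+1 x).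
    by rewrite -big_split/=; apply: eq_bigr => x _; rewrite -mulrDr subrKA.
  by apply: (le_trans (lerD IHl sm)); rewrite (epsS l); lra.
(* The cutoffs from [i] to [j] cost at most [2 * eps i - 2 * eps j], and removing [F j] costs less
   than [eps j]. *)
have close i j : (i <= j)%N -> \sum_(x <- S j) `|lam (n j) x * h i x - w j x| <= 2 * eps i.
  move=> ij; apply: (@le_trans _ _ (\sum_(x <- S j) `|lam (n j) x| * (h i x - h j x) +
      fsvariation (lam (n j)) [set` F j])).
    rewrite /fsvariation [X in _ + X]big_mkcond -big_split/= ler_sum// => x _.
    have hij := hle i j x ij; rewrite mem_setE /w; case: ifPn => xF.
      rewrite subr0 normrM (ger0_norm (hge0 i x)) -[X in _ + X]mulr1 -mulrDr ler_wpM2l//.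
      by have := hle 0%N j x (leq0n j); rewrite h0; lra.
    by rewrite addr0 -mulrBr normrM (@ger0_norm _ (_ - _))// subr_ge0.
  have := tele i j j; rewrite ij leqnn => /(_ isT) t.
  have := fsvariation_finset (lam (n j)) (F j); have [_ f] := nF j.
  by have := eps_gt0 j; lra.
pose c j := \sum_(x <- S j) `|w j x|.
have c2 j : 1 / 2 <= c j.
  have cl := close 0%N j (leq0n j).
  have : 1 <= \sum_(x <- S j) `|lam (n j) x * h 0%N x - w j x| + c j.
    rewrite -(lam1 (n j)) /fsnorm -big_split ler_sum// => x _.
    by rewrite h0 mulr1 -lerBlDr lerB_dist.
  have e0 : eps 0 = 1 / 4 by rewrite /eps expr2; lra.
  by move: cl; rewrite e0; lra.
have c0 j : 0 < c j by have := c2 j; lra.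
have ci j : (c j)^-1 <= 2 by rewrite invf_ple ?posrE//; have := c2 j; lra.
pose nu j := weighted (S j) (fun x => (c j)^-1 * w j x).
have nuP j x : x \in finsupp (nu j) -> [/\ x \in S j, x \notin F j & h j x != 0].
  rewrite mem_finsupp weightedE; case: ifP => xS; last by rewrite eqxx.
  rewrite /w; case: ifP => xF; first by rewrite mulr0 eqxx.
  by rewrite !mulf_eq0 !negb_or => /and3P[].
(* Later measures carry a factor at most [h j.+1], which vanishes near [x]. *)
have isol j x : x \in finsupp (nu j) -> \forall y \near x,
    forall k, (j < k)%N -> y \notin finsupp (nu k).
  move=> /nuP[xS xF _]; apply: filterS (hvan j x xS xF) => y hy k jk.
  apply/negP => /nuP[_ _ /negP]; apply.
  by rewrite eq_le hge0 andbT -hy; exact: hle.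
exists nu; split.
- split=> [j|f cf].
    rewrite fsnorm_weighted.
    under eq_bigr do rewrite normrM (ger0_norm (ltW _)) ?invr_gt0//.
    by rewrite -mulr_sumr mulVf// gt_eqF.
  have [C HC] := fsint_cvg0_bounded tychX JNlam.2 cf.
  have C0 : 0 < `|C| + 1 by rewrite ltr_wpDl.
  have fC j x : x \in S j -> `|f x| <= `|C| + 1.
    by move=> /HC /le_trans; apply; have := ler_norm C; lra.
  (* With [i] fixed, [h i] times [f] is one continuous function for all [j]; the factor 2 comes from
     normalization. *)
  have bound i j : (i <= j)%N -> `|fsint (nu j) f| <=
      2 * (`|fsint (lam (n j)) (fun x => h i x * f x)| + (`|C| + 1) * (2 * eps i)).
    move=> ij; rewrite fsint_weighted.
    under eq_bigr do rewrite -mulrA.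
    rewrite -mulr_sumr normrM ler_pM//; first by rewrite ger0_norm ?invr_ge0 ?(ltW (c0 j)).
    rewrite -lerBlDl; apply: le_trans (lerB_dist _ _) _.
    rewrite distrC /fsint -sumrB; apply: le_trans (ler_norm_sum _ _ _) _.
    apply: (@le_trans _ _ ((`|C| + 1) * \sum_(x <- S j) `|lam (n j) x * h i x - w j x|)).
      rewrite mulr_sumr big_seq [leRHS]big_seq ler_sum// => x xS.
      rewrite mulrA -mulrBl normrM mulrC ler_wpM2r//; exact: fC xS.
    by rewrite ler_wpM2l ?close// ltW.
  (* This [i] keeps the error term below [e / 2]; large [j] then bring the other term below
     [e / 2]. *)
  apply/cvgr0Pnorm_lt => e e0.
  have /cvgr0_norm_lt/(_ (e / (8 * (`|C| + 1)))) := eps_cvg0.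
  rewrite divr_gt0 ?mulr_gt0// => /(_ isT)/filter_ex[i].
  rewrite gtr0_norm ?eps_gt0// ltr_pdivlMr ?mulr_gt0// => ei.
  have ncr : n j @[j --> \oo] --> \oo.
    by apply/cvgnyPge => A; exists A => // k /= Ak; have [kn _] := nF k; exact: leq_trans kn.
  have chf : continuous (fun x => h i x * f x).
    by move=> x; apply: cvgM; [exact: ch|exact: cf].
  have /cvgr0_norm_lt/(_ (e / 4)) := cvg_comp _ _ ncr (JNlam.2 _ chf).
  rewrite divr_gt0// => /(_ isT) near_e.
  near=> j.
  have ij : (i <= j)%N by near: j; exists i.
  apply: (le_lt_trans (bound i j ij)).
  have : `|fsint (lam (n j)) (fun x => h i x * f x)| < e / 4 by near: j.
  lra.
- by move=> x [j _ /nuP[xS _ _]]; exists (n j).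
- move=> j k jk; apply/seteqP; split=> // x [xj xk].
  have [jk'|jk'|//] := ltngtP j k.
    by have /nbhs_singleton/(_ k jk')/negP := isol j x xj.
  by have /nbhs_singleton/(_ j jk')/negP := isol k x xk.
- apply/discrete_subsetE/seteqP; split; first exact: isolatedS.
  move=> x [j _ xj]; split; first by apply/mem_set; exists j.
  (* [D] contains the supports up to index [j]: removing its points other than [x] handles these,
     and [isol] handles the later ones. *)
  have [D HD] := finsupp_initial nu j.+1.
  have nD : nbhs x (~` [set` (D `\ x)%fset]).
    apply: open_nbhs_nbhs; split; last by rewrite /= !inE eqxx.
    exact/closed_openC/tychonoff_finite_closed.
  exists (~` [set` (D `\ x)%fset] `&`
      [set y | forall k, (j < k)%N -> y \notin finsupp (nu k)]).
    by apply: filterI => //; exact: isol.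
  apply/seteqP; split=> [y [[yD yk] [k _ ynu]]|y ->]; last first.
    by split; [split; [exact: nbhs_singleton nD|exact: nbhs_singleton (isol j x xj)]|exists j].
  apply: contrapT => yx; have [jk|kj] := ltnP j k.
    by have /negP := yk k jk.
  apply: yD; rewrite /= !inE (fsubsetP (HD k _))// andbT.
  exact/eqP.
Unshelve. all: by end_near. Qed.

End DisjointDiscrete.

(** * The two reductions combined *)

Theorem theorem1p2 (R : realType) (X : topologicalType)
    (tychX : tychonoff_space X)
    (mu : nat -> fsmeasure R X) (JNmu : JN_sequence mu) :
  exists nu : nat -> fsmeasure R X,
    [/\ JN_sequence nu,
        \bigcup_n supp (nu n) `<=` \bigcup_n supp (mu n),
        forall n k : nat, n <> k -> supp (nu n) `&` supp (nu k) = set0 &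
        discrete_subset (\bigcup_n supp (nu n))].
Proof.
have [lam [JNlam lam_mu lam_null]] := JN_pointwise_null tychX JNmu.
have [nu [JNnu nu_lam nu_disj nu_discr]] :=
  disjoint_discrete_JN tychX JNlam lam_null.
by exists nu; split => //; exact: subset_trans lam_mu.
Qed.
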